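(* Let $\mathcal L=\{L_0,L_\infty,L_1,\ldots,L_r\}$ be a set of pairwise skew lines in $\mathbb P^3_K$, where $L_0=\{(v,0)\}$, $L_\infty=\{(0,v)\}$, and $L_i=\{(v,M_iv)\}$ for $1\le i\le r$, with corresponding matrices $M_0=0$, $M_1=I$, and $M_2,\ldots,M_r\in\mathrm{GL}_2(K)$. Let $\mathcal L'\subseteq\mathcal L$ be any subset consisting of at least three lines. Then the group $G_{\mathcal L'}$, realized as the group $G_i(\mathcal L')$ at a line $L_i\in\mathcal L'$ and viewed in $\mathrm{PGL}_2(K)$ via the parametrization of $L_i$, is generated by the closed compositions (starting and ending on $L_i$) represented by $$F_{jih}F_{ijk}\qquad\text{and}\qquad F_{kic}F_{jkb}F_{ija},$$ where all indices are chosen among the indices of the lines of $\mathcal L'$, and each triple of indices appearing in an $F_{\alpha\beta\gamma}$ consists of distinct indices.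
   Context: $K$ is an algebraically closed field and $\mathbb P^3=\mathbb P(K^2\oplus K^2)$; points are written $(u,w)$ with $u,w\in K^2$, not both zero, up to common scaling. Two lines are skew if they are disjoint. Every line skew to both $L_0$ and $L_\infty$ is $\{(v,Mv)\mid v\in K^2\}$ for a unique $M\in\mathrm{GL}_2(K)$, its corresponding matrix. For three distinct pairwise skew lines $L_i,L_j,L_k$, the map $f_{ijk}:L_i\to L_j$ sends $p\in L_i$ to the unique intersection point of $L_j$ with the plane spanned by $p$ and $L_k$. For a finite set $\mathcal L'$ of at least three pairwise skew lines, $C_{\mathcal L'}$ is the groupoid whose objects are the lines of $\mathcal L'$ and whose arrows are the maps $f_{ijk}$ (with $L_i,L_j,L_k\in\mathcal L'$ distinct) together with all their possible compositions; $G_i(\mathcal L')=\mathrm{Hom}_{C_{\mathcal L'}}(L_i,L_i)\subseteq\mathrm{Aut}(L_i)$; these groups are isomorphic for all $i$, and $G_{\mathcal L'}$ denotes this common group. The parametrizations $\mathbb P(K^2)\simeq L_i$ are $[v]\mapsto(v,M_iv)$ for $i\in\{0,1,\ldots,r\}$ and $[v]\mapsto(0,v)$ for $i=\infty$; $F_{ijk}\in\mathrm{PGL}_2(K)$ is the element representing $f_{ijk}$ under these parametrizations. Products denote composition, applied from right to left. *)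

(* Defs.v *)
From HB Require Import structures.
From mathcomp Require Import all_boot all_order all_algebra.
From mathcomp Require Import finmap.

Set Implicit Arguments.
Unset Strict Implicit.
Unset Printing Implicit Defensive.

Import GRing.Theory.
Local Open Scope ring_scope.
Local Open Scope quotient_scope.

(* PGL_2(K) is GL_2(K) modulo scalar matrices. Matrices act on column vectors,
   so a product of matrices is a composition applied from right to left. *)
Section PGL2.
Variable K : fieldType.

Definition GL2 := {A : 'M[K]_2 | A \in unitmx}.

Definition scal_equiv (A B : GL2) : bool := is_scalar_mx (val A *m invmx (val B)).

Lemma scal_equivP (A B : GL2) :
  reflect (exists2 c : K, c != 0 & val A = c *: val B) (scal_equiv A B).
Proof.
apply: (iffP is_scalar_mxP) => [[c cE]|[c c0 ->]]; last first.
  by exists c; rewrite -scalemxAl mulmxV ?(valP B) // scalemx1.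
have AE : val A = c *: val B.
  by rewrite -[LHS](mulmxKV (valP B)) cE mul_scalar_mx.
exists c => //; apply: contraTneq (valP A) => c0.
by rewrite AE c0 scale0r unitmxE det0 unitr0.
Qed.

Lemma scal_equiv_refl : reflexive scal_equiv.
Proof. by move=> A; apply/scal_equivP; exists 1; rewrite ?oner_eq0 ?scale1r. Qed.

Lemma scal_equiv_sym : symmetric scal_equiv.
Proof.
suff h A B : scal_equiv A B -> scal_equiv B A by move=> A B; apply/idP/idP; apply: h.
case/scal_equivP=> c c0 E; apply/scal_equivP; exists c^-1; rewrite ?invr_eq0 //.
by rewrite E scalerK.
Qed.

Lemma scal_equiv_trans : transitive scal_equiv.
Proof.
move=> B A C /scal_equivP[c c0 cE] /scal_equivP[d d0 dE]; apply/scal_equivP.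
by exists (c * d); rewrite ?mulf_neq0 // cE dE scalerA.
Qed.

Canonical scal_equiv_rel :=
  EquivRel scal_equiv scal_equiv_refl scal_equiv_sym scal_equiv_trans.

Definition PGL2 := {eq_quot scal_equiv}.
HB.instance Definition _ := Choice.on PGL2.
HB.instance Definition _ := EqQuotient.on PGL2.

Lemma GL2_mul_subproof (A B : GL2) : val A *m val B \in unitmx.
Proof. by rewrite unitmx_mul (valP A) (valP B). Qed.
Lemma GL2_inv_subproof (A : GL2) : invmx (val A) \in unitmx.
Proof. by rewrite unitmx_inv (valP A). Qed.

Definition GL2_one : GL2 := Sub 1%:M (unitmx1 _ _).
Definition GL2_mul (A B : GL2) : GL2 := Sub (val A *m val B) (GL2_mul_subproof A B).
Definition GL2_inv (A : GL2) : GL2 := Sub (invmx (val A)) (GL2_inv_subproof A).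

Definition PGL2_one : PGL2 := \pi_PGL2 GL2_one.
Definition PGL2_mul (x y : PGL2) : PGL2 := \pi_PGL2 (GL2_mul (repr x) (repr y)).
Definition PGL2_inv (x : PGL2) : PGL2 := \pi_PGL2 (GL2_inv (repr x)).

Lemma PGL2_eqP (A B : GL2) :
  reflect (exists2 c : K, c != 0 & val A = c *: val B) (\pi_PGL2 A == \pi_PGL2 B).
Proof. by rewrite piE; apply: scal_equivP. Qed.

Lemma PGL2_reprP (A : GL2) :
  exists2 c : K, c != 0 & val (repr (\pi_PGL2 A)) = c *: val A.
Proof. by apply/PGL2_eqP; rewrite reprK. Qed.

Lemma PGL2_mulE (A B : GL2) :
  PGL2_mul (\pi_PGL2 A) (\pi_PGL2 B) = \pi_PGL2 (GL2_mul A B).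
Proof.
have [c c0 cE] := PGL2_reprP A; have [d d0 dE] := PGL2_reprP B.
apply/eqP/PGL2_eqP; exists (c * d); rewrite ?mulf_neq0 //=.
by rewrite cE dE -scalemxAl -scalemxAr scalerA.
Qed.

Lemma PGL2_invE (A : GL2) : PGL2_inv (\pi_PGL2 A) = \pi_PGL2 (GL2_inv A).
Proof.
have [c c0 cE] := PGL2_reprP A.
apply/eqP/PGL2_eqP; exists c^-1; rewrite ?invr_eq0 //= cE invmxZ //.
by rewrite unitmxZ ?unitfE // (valP A).
Qed.

Lemma PGL2_mulA : associative PGL2_mul.
Proof.
elim/quotW=> A; elim/quotW=> B; elim/quotW=> C.
rewrite (PGL2_mulE B C) (PGL2_mulE A B) !PGL2_mulE.
by apply: (congr1 \pi_PGL2); apply: val_inj; rewrite /= mulmxA.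
Qed.

Lemma PGL2_mul1 : left_id PGL2_one PGL2_mul.
Proof.
elim/quotW=> A; rewrite PGL2_mulE.
by apply: (congr1 \pi_PGL2); apply: val_inj; rewrite /= mul1mx.
Qed.

Lemma PGL2_mulr1 : right_id PGL2_one PGL2_mul.
Proof.
elim/quotW=> A; rewrite PGL2_mulE.
by apply: (congr1 \pi_PGL2); apply: val_inj; rewrite /= mulmx1.
Qed.

Lemma PGL2_mulV : left_inverse PGL2_one PGL2_inv PGL2_mul.
Proof.
elim/quotW=> A; rewrite PGL2_invE PGL2_mulE.
by apply: (congr1 \pi_PGL2); apply: val_inj; rewrite /= mulVmx ?(valP A).
Qed.

Lemma PGL2_mulrV : right_inverse PGL2_one PGL2_inv PGL2_mul.
Proof.
elim/quotW=> A; rewrite PGL2_invE PGL2_mulE.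
by apply: (congr1 \pi_PGL2); apply: val_inj; rewrite /= mulmxV ?(valP A).
Qed.

HB.instance Definition _ := isGroup.Build PGL2
  PGL2_mulA PGL2_mul1 PGL2_mulr1 PGL2_mulV PGL2_mulrV.

End PGL2.

Definition subgroup (G : groupType) (H : G -> Prop) : Prop :=
  H 1%g /\ forall x y, H x -> H y -> H (x * y^-1)%g.

Definition generated (G : groupType) (X : G -> Prop) (x : G) : Prop :=
  forall H : G -> Prop, subgroup H -> (forall y, X y -> H y) -> H x.

(* Points and lines of P^3 = P(K^2 + K^2) are the subspaces of K^2 + K^2 of
   dimension 1 and 2. *)
Section Lines.
Variable K : fieldType.

Definition V4 : vectType K := ('cV[K]_2 * 'cV[K]_2)%type.

Definition line := {U : {vspace V4} | \dim U == 2}.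
HB.instance Definition _ := Choice.on line.

Definition point_on (L : line) :=
  {p : {vspace V4} | (\dim p == 1) && (p <= val L)%VS}.

Definition skew_lines (L L' : line) : bool := (val L :&: val L' == 0)%VS.

(* Skew lines are automatically distinct. *)
Definition skew3 (Li Lj Lk : line) : bool :=
  [&& skew_lines Li Lj, skew_lines Li Lk & skew_lines Lj Lk].

Lemma dim_V4 : \dim {: V4} = 4.
Proof. by rewrite dimvf. Qed.

Lemma skew_addv (L L' : line) : skew_lines L L' -> (val L + val L')%VS = fullv.
Proof.
move=> /eqP s; apply/eqP; rewrite eqEdim subvf dim_V4 /=.
by rewrite dimv_disjoint_sum // (eqP (valP L)) (eqP (valP L')).
Qed.

Lemma fijk_subproof (Li Lj Lk : line) (s : skew3 Li Lj Lk) (p : point_on Li) :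
  let q := ((val p + val Lk) :&: val Lj)%VS in (\dim q == 1) && (q <= val Lj)%VS.
Proof.
case/and3P: s => _ /eqP sik sjk; rewrite /= capvSr andbT.
have /andP[/eqP dp spL] := valP p.
have dpk : \dim (val p + val Lk) = 3.
  rewrite dimv_disjoint_sum ?dp ?(eqP (valP Lk)) //.
  by apply/eqP; rewrite -subv0 -sik capvS.
have full : (val p + val Lk + val Lj)%VS = fullv.
  apply/eqP; rewrite eqEsubv subvf -(skew_addv sjk) subv_add addvSr /=.
  by rewrite (subv_trans (addvSr (val p) _)) ?addvSl.
have := dimv_sum_cap (val p + val Lk) (val Lj).
by rewrite full dpk (eqP (valP Lj)) dim_V4 => /eqP; rewrite (eqn_add2l 4 _ 1).
Qed.

(* f_{ijk} sends p to the intersection of L_j with the plane p + L_k. *)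
Definition fijk (Li Lj Lk : line) (s : skew3 Li Lj Lk) (p : point_on Li) : point_on Lj :=
  Sub ((val p + val Lk) :&: val Lj)%VS (fijk_subproof s p).

(* Arrows of the groupoid C_LL. The identities need no constructor: f_{jik} is inverse to
   f_{ijk}, and #|LL| >= 3 in every use. *)
Inductive arrow (LL : {fset line}) :
    forall L L' : line, (point_on L -> point_on L') -> Prop :=
  | arrow_f Li Lj Lk (s : skew3 Li Lj Lk) :
      Li \in LL -> Lj \in LL -> Lk \in LL -> arrow LL (fijk s)
  | arrow_comp L L' L'' (g : point_on L -> point_on L') (h : point_on L' -> point_on L'') :
      arrow LL g -> arrow LL h -> arrow LL (h \o g).

End Lines.

(* The index None stands for infinity. *)
Section Parametrization.
Variables (K : fieldType) (r : nat) (M : 'I_r.+1 -> 'M[K]_2).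
Notation index := (option 'I_r.+1).

Definition param (i : index) (v : 'cV[K]_2) : V4 K :=
  if i is Some a then (v, M a *m v) else (0, v).

Lemma param_is_linear (i : index) : linear (param i).
Proof.
case: i => [a|] c u v; rewrite /param; last by congr pair; rewrite /= scaler0 addr0.
by congr pair; rewrite mulmxDr -scalemxAr.
Qed.
HB.instance Definition _ (i : index) :=
  GRing.isLinear.Build K 'cV[K]_2 (V4 K) *:%R (param i) (param_is_linear i).

Lemma param_inj (i : index) : injective (param i).
Proof. by case: i => [a|] u v []. Qed.

Lemma line_ofijk_subproof (i : index) : \dim (limg (linfun (param i))) == 2.
Proof.
have k0 : lker (linfun (param i)) == 0%VS.
  by apply/lker0P => u v; rewrite !lfunE => /param_inj.
by rewrite limg_dim_eq ?(eqP k0) ?capv0 // dimvf.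
Qed.

Definition line_of (i : index) : line K :=
  Sub (limg (linfun (param i))) (line_ofijk_subproof i).

Definition represents (i j : index) (A : PGL2 K)
    (g : point_on (line_of i) -> point_on (line_of j)) : Prop :=
  forall (p : point_on (line_of i)) (v : 'cV[K]_2),
    val p = <[param i v]>%VS -> val (g p) = <[param j (val (repr A) *m v)]>%VS.

Lemma mem_line_of (i : index) (v : 'cV[K]_2) : param i v \in val (line_of i).
Proof. by rewrite /= -[param i v](lfunE (param i)) memv_img ?memvf. Qed.

Lemma point_paramP (i : index) (p : point_on (line_of i)) :
  exists2 v : 'cV[K]_2, v != 0 & val p = <[param i v]>%VS.
Proof.
have /andP[/eqP dp sp] := valP p.
have n0 : vpick (val p) != 0 by rewrite vpick0 -dimv_eq0 dp.
have /memv_imgP[v _ vE] := subvP sp _ (memv_pick (val p)).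
rewrite lfunE /= in vE.
exists v; first by apply: contra_neq n0 => v0; rewrite vE v0 linear0.
apply/eqP; rewrite eq_sym eqEdim dp dim_vline -vE n0 andbT.
by rewrite -memvE memv_pick.
Qed.

Lemma line_zmulr (c : K) (w : V4 K) : c != 0 -> <[c *: w]>%VS = <[w]>%VS.
Proof.
move=> c0; apply/eqP; rewrite eqEsubv -!memvE memvZ ?memv_line //=.
by rewrite -{1}[w](scalerK c0) memvZ ?memv_line.
Qed.

Lemma represents_pi (i j : index) (A : GL2 K)
    (g : point_on (line_of i) -> point_on (line_of j)) :
  (forall p v, val p = <[param i v]>%VS -> val (g p) = <[param j (val A *m v)]>%VS) ->
  represents (\pi_(PGL2 K) A) g.
Proof.
move=> h p v pE; have [c c0 ->] := PGL2_reprP A.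
by rewrite -scalemxAl linearZ line_zmulr // (h _ _ pE).
Qed.

Lemma represents_mul (i j k : index) (A B : PGL2 K)
    (g : point_on (line_of i) -> point_on (line_of j))
    (h : point_on (line_of j) -> point_on (line_of k)) :
  represents A g -> represents B h -> represents (B * A)%g (h \o g).
Proof.
move=> rA rB; apply: represents_pi => p v pE /=.
by rewrite -mulmxA; apply/rB/rA.
Qed.

Lemma Fijk_exists (i j k : index) (s : skew3 (line_of i) (line_of j) (line_of k)) :
  {A : PGL2 K | represents A (fijk s)}.
Proof.
case/and3P: (s) => _ /eqP sik sjk.
pose Lj := val (line_of j); pose Lk := val (line_of k).
have jk0 : (Lj :&: Lk = 0)%VS by apply/eqP.
pose pj := daddv_pi Lj Lk.
pose g (u : 'rV[K]_2) : 'rV[K]_2 :=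
  ((linfun (param j))^-1%VF (pj (param i u^T)))^T.
have glin : linear g.
  by move=> c u v; rewrite /g !linearP.
pose gL := GRing.isLinear.Build K 'rV[K]_2 'rV[K]_2 *:%R g glin.
pose gl : {linear 'rV[K]_2 -> 'rV[K]_2} := HB.pack g gL.
pose N := (lin1_mx gl)^T.
have NE v : param j (N *m v) = pj (param i v).
  have -> : N *m v = (g v^T)^T.
    by rewrite /N -[v in LHS]trmxK -trmx_mul mul_rV_lin1.
  by rewrite /g !trmxK -[LHS](lfunE (param j)) limg_lfunVK // memv_pi.
have wE w : w = pj w + daddv_pi Lk Lj w.
  by rewrite daddv_pi_add // (skew_addv sjk) memvf.
have Ninj (v : 'cV_2) : N *m v = 0 -> v = 0.
  move=> N0; apply: (@param_inj i); rewrite [RHS]linear0.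
  have := wE (param i v); rewrite -NE N0 linear0 add0r => E.
  apply/eqP; rewrite -memv0 -sik memv_cap mem_line_of E memv_pi //.
have Nu : N \in unitmx.
  rewrite -unitmx_tr -row_free_unit; apply: inj_row_free => v vN.
  by apply: trmx_inj; rewrite trmx0; apply: Ninj; apply: trmx_inj;
     rewrite trmx_mul trmxK trmx0.
exists (\pi_(PGL2 K) (Sub N Nu : GL2 K)); apply: represents_pi => p v pE.
rewrite [val (Sub N Nu : GL2 K)]/= NE.
have v0 : v != 0.
  have /andP[/eqP dp _] := valP p; apply: contra_eqN dp => /eqP v0.
  by rewrite pE v0 linear0 dim_vline eqxx.
have w0 : pj (param i v) != 0.
  apply: contra_neq v0 => w0; apply: Ninj; apply: (@param_inj j).
  by rewrite NE w0 linear0.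
have /andP[/eqP dq _] := valP (fijk s p).
apply/esym/eqP; rewrite eqEdim dq dim_vline w0 andbT -memvE memv_cap memv_pi andbT.
have -> : pj (param i v) = param i v - daddv_pi Lk Lj (param i v).
  by rewrite {2}(wE (param i v)) addrK.
by rewrite memv_add ?memvN ?memv_pi // pE memv_line.
Qed.

(* An element representing a map g is unique. *)
Lemma represents_inj (i j : index) (A B : PGL2 K)
    (g : point_on (line_of i) -> point_on (line_of j)) :
  represents A g -> represents B g -> A = B.
Proof.
move=> rA rB.
pose C := invmx (val (repr B)) *m val (repr A).
have Cv (v : 'cV_2) : exists c, C *m v = c *: v.
  have [->|v0] := eqVneq v 0; first by exists 0; rewrite mulmx0 scaler0.
  have pP : (\dim <[param i v]> == 1)%N && (<[param i v]> <= val (line_of i))%VS.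
    rewrite -memvE mem_line_of dim_vline andbT eqb1.
    by apply: contra_neq v0 => w0; apply: (@param_inj i); rewrite w0 linear0.
  pose p : point_on (line_of i) := Sub <[param i v]>%VS pP.
  have := rA p v erefl; rewrite (rB p v erefl) => E.
  have : param j (val (repr A) *m v) \in <[param j (val (repr B) *m v)]>%VS.
    by rewrite E memv_line.
  case/vlineP=> c; rewrite -linearZ => /param_inj cE; exists c.
  by rewrite /C -mulmxA cE -scalemxAr mulKmx // (valP (repr B)).
pose e (a : 'I_2) : 'cV[K]_2 := delta_mx a 0.
have Ce a b : (C *m e a) b 0 = C b a.
  by rewrite -colE mxE.
have off a b : a != b -> C b a = 0.
  move=> ab; rewrite -Ce; have [c ->] := Cv (e a).
  by rewrite !mxE eqxx andbT eq_sym (negPf ab) mulr0.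
have diag a b : a != b -> C a a = C b b.
  move=> ab; have [c cE] := Cv (e a + e b).
  have ha : C a a = c.
    have := congr1 (fun m : 'cV_2 => m a 0) cE.
    by rewrite /= mulmxDr mxE !Ce (off b a) 1?eq_sym // !mxE !eqxx (negPf ab) !addr0 mulr1.
  have := congr1 (fun m : 'cV_2 => m b 0) cE.
  rewrite /= mulmxDr mxE !Ce (off a b) // ha !mxE !eqxx (eq_sym b) (negPf ab).
  by rewrite !add0r mulr1.
have [c CE] : exists c, C = c%:M.
  exists (C 0 0); apply/matrixP => a b; rewrite [RHS]mxE.
  have [->|ab] := eqVneq a b; last by rewrite off // eq_sym.
  by rewrite mulr1n; have [->|b0] := eqVneq b 0; last exact: diag.
rewrite -[A]reprK -[B]reprK; apply/eqP; rewrite piE; apply/is_scalar_mxP.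
exists c; rewrite -[val (repr A)](mulKVmx (valP (repr B))) -/C CE.
by rewrite mul_mx_scalar -scalemxAl mulmxV ?(valP (repr B)) // scalemx1.
Qed.

(* The element representing f_{ijk}: see Fijk_represents, and represents_inj
   for its uniqueness. The value is 1 if the lines are not pairwise skew. *)
Definition Fijk (i j k : index) : PGL2 K :=
  if @idP (skew3 (line_of i) (line_of j) (line_of k)) is ReflectT s
  then sval (Fijk_exists s) else 1%g.

Lemma Fijk_represents (i j k : index) (s : skew3 (line_of i) (line_of j) (line_of k)) :
  represents (Fijk i j k) (fijk s).
Proof.
rewrite /Fijk; case: {-}_ / idP => [s'|//].
by rewrite (bool_irrelevance s s'); apply: (svalP (Fijk_exists s')).
Qed.

Lemma arrow_represented (LL : {fset line K}) :
  (forall L, L \in LL -> exists i, L = line_of i) ->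
  forall i j (g : point_on (line_of i) -> point_on (line_of j)),
    arrow LL g -> exists A : PGL2 K, represents A g.
Proof.
move=> LLi.
have memh L L' (g : point_on L -> point_on L') : arrow LL g -> L \in LL /\ L' \in LL.
  by elim=> [Li Lj Lk s ? ? ?|L1 L2 L3 g1 g2 _ [? _] _ [_ ?]].
suff IH L L' (g : point_on L -> point_on L') : arrow LL g ->
    forall i j, L = line_of i -> L' = line_of j ->
    exists A : PGL2 K, forall p v, val p = <[param i v]>%VS ->
      val (g p) = <[param j (val (repr A) *m v)]>%VS.
  by move=> i j g /IH/(_ i j erefl erefl)[A hA]; exists A.
elim=> {L L' g} [Li Lj Lk s _ _ /LLi[k kE]|L L1 L' g h hg IHg hh IHh] i j iE jE.
  by subst Li Lj Lk; exists (Fijk i j k); apply: (Fijk_represents s).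
have [_ /LLi[k kE]] := memh _ _ _ hg.
have [A hA] := IHg i k iE kE; have [B hB] := IHh k j kE jE.
subst L L1 L'; exists (B * A)%g; exact: (represents_mul hA hB).
Qed.

(* The image of G_i(LL) in PGL_2(K); by arrow_represented every arrow of
   G_i(LL) is represented by some element. *)
Definition Gi (LL : {fset line K}) (i : index) (A : PGL2 K) : Prop :=
  exists2 g : point_on (line_of i) -> point_on (line_of i), arrow LL g & represents A g.

Definition closed_compositions (LL : {fset line K}) (i : index) (A : PGL2 K) : Prop :=
  (exists j k h : index,
     [/\ all (fun a => line_of a \in LL) [:: i; j; k; h],
         uniq [:: i; j; k], uniq [:: j; i; h] &
         A = (Fijk j i h * Fijk i j k)%g])
  \/
  (exists j k a b c : index,
     [/\ all (fun d => line_of d \in LL) [:: i; j; k; a; b; c],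
         uniq [:: i; j; a], uniq [:: j; k; b], uniq [:: k; i; c] &
         A = (Fijk k i c * Fijk j k b * Fijk i j a)%g]).

End Parametrization.

(* Main.v *)
(* Fix for every line L_a of L' other than L_i one arrow T_a = f_{iak} from L_i,
   and put T_i = 1. These arrows form a spanning tree of the groupoid, so a
   closed path through L_i is the product of the loops T_b^-1 f_{abc} T_a over
   its steps f_{abc}. As f_{jik} is inverse to f_{ijk}, such a loop has the form
   F_{jih} F_{ijk} if a or b is i, and the form F_{kic} F_{jkb} F_{ija}
   otherwise. *)
Require Import Defs.
From mathcomp Require Import all_boot all_order all_algebra.
From mathcomp Require Import finmap.

Import GRing.Theory.
Local Open Scope ring_scope.

Section GroupoidGenerators.
Set Implicit Arguments.
Unset Strict Implicit.

Lemma generated_subgroup (G : groupType) (X : G -> Prop) : subgroup (generated X).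
Proof.
split=> [H [] //|x y gx gy H sH XH].
by case: (sH) => _; apply; [apply: gx | apply: gy].
Qed.

Lemma subgroupM (G : groupType) (H : G -> Prop) (x y : G) :
  subgroup H -> H x -> H y -> H (x * y)%g.
Proof.
case=> H1 HV Hx Hy; rewrite -[y]invgK; apply: (HV) => //.
by rewrite -[y^-1%g]mul1g; apply: HV.
Qed.

(** * Inverses in the groupoid of lines *)

Section Lines.
Variable K : fieldType.
Implicit Types L : line K.

Lemma skew_lines_irrefl L : skew_lines L L = false.
Proof. by rewrite /skew_lines capvv -dimv_eq0 (eqP (valP L)). Qed.

Lemma skew_lines_sym L L' : skew_lines L L' = skew_lines L' L.
Proof. by rewrite /skew_lines capvC. Qed.

Lemma skew3_sym12 (Li Lj Lk : line K) : skew3 Li Lj Lk -> skew3 Lj Li Lk.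
Proof. by case/and3P=> sij sik sjk; apply/and3P; rewrite skew_lines_sym. Qed.

(** The image [q] lies in the plane spanned by [p] and [Lk], so [q] and [Lk] span that same plane,
    which meets [Li] exactly in [p]. *)
Lemma fijkK (Li Lj Lk : line K) (s : skew3 Li Lj Lk) (s' : skew3 Lj Li Lk) :
  cancel (fijk s) (fijk s').
Proof.
move=> p; apply: val_inj; set q := fijk s p.
case/and3P: (s) => _ sik sjk.
have /andP[/eqP dp pLi] := valP p; have /andP[/eqP dq qLj] := valP q.
have /andP[/eqP dp' _] := valP (fijk s' q).
(* A point on a line skew to [Lk] is off [Lk], so it spans a plane with [Lk]. *)
have dimD L (t : point_on L) :
    skew_lines L Lk -> \dim (val t) = 1 -> \dim (val t + val Lk) = 3.
  move=> /eqP sL dt; have /andP[_ tL] := valP t.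
  rewrite dimv_disjoint_sum ?dt ?(eqP (valP Lk)) //.
  by apply/eqP; rewrite -subv0 -sL capvS.
have qpE : (val q + val Lk)%VS = (val p + val Lk)%VS.
  apply/eqP; rewrite eqEdim (dimD _ p) // (dimD _ q) // leqnn andbT.
  by rewrite subv_add addvSr capvSl.
apply/esym/eqP; rewrite eqEdim dp dp' andbT /= subv_cap pLi andbT.
by rewrite [X in (_ <= X)%VS]qpE addvSl.
Qed.

(** A one-sided inverse is enough, since the representing elements live in a group. *)
Lemma arrow_inverse (LL : {fset line K}) L L' (g : point_on L -> point_on L') :
  arrow LL g -> exists2 h : point_on L' -> point_on L, arrow LL h & cancel g h.
Proof.
elim=> {L L' g} [Li Lj Lk s iL jL kL|L L' L'' g h _ [g' ag' gK] _ [h' ah' hK]].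
  by exists (fijk (skew3_sym12 s)); [apply: arrow_f | apply: fijkK].
by exists (g' \o h'); [apply: arrow_comp | move=> p /=; rewrite hK gK].
Qed.

Lemma arrow_mem (LL : {fset line K}) L L' (g : point_on L -> point_on L') :
  arrow LL g -> L \in LL /\ L' \in LL.
Proof. by elim=> [Li Lj Lk s ? ? ?|L1 L2 L3 g1 g2 _ [? _] _ [_ ?]]. Qed.

End Lines.

(** * The image of the groupoid in PGL_2 *)

Section Groupoid.
Variables (K : fieldType) (r : nat) (M : 'I_r.+1 -> 'M[K]_2).
Notation index := (option 'I_r.+1).
Implicit Types i j k : index.
Hypothesis skewL :
  forall i j, i != j -> skew_lines (line_of M i) (line_of M j).
Variable LL : {fset line K}.
Hypothesis LL_line : forall L, L \in LL -> exists i, L = line_of M i.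
Hypothesis LL_card : (3 <= #|` LL|)%N.
Notation inLL i := (line_of M i \in LL).

Lemma skew_line_of i j : skew_lines (line_of M i) (line_of M j) = (i != j).
Proof.
apply/idP/idP=> [s|]; last exact: skewL.
by apply/eqP=> ij; rewrite ij skew_lines_irrefl in s.
Qed.

(** Translates the index conditions of [closed_compositions] into the geometric condition under
    which [fijk] is defined. *)
Lemma skew3_line_of i j k :
  skew3 (line_of M i) (line_of M j) (line_of M k) = uniq [:: i; j; k].
Proof. by rewrite /skew3 !skew_line_of /= !inE negb_or andbT -andbA. Qed.

Lemma third_line i j : exists2 k, inLL k & (k != i) && (k != j).
Proof.
have [L LLL Lij] : exists2 L, L \in LL & L \notin [:: line_of M i; line_of M j].
  apply/hasP; rewrite has_predC; apply/negP=> /allP sub.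
  by have := uniq_leq_size (fset_uniq LL) sub; rewrite leqNgt LL_card.
have [k kE] := LL_line LLL; exists k; first by rewrite -kE.
rewrite -negb_or; apply: contra Lij; rewrite kE !inE.
by case/orP=> /eqP->; rewrite eqxx ?orbT.
Qed.

Lemma represents_id i (g : point_on (line_of M i) -> point_on (line_of M i)) :
  g =1 id -> represents 1%g g.
Proof.
by move=> gE; apply: represents_pi => p v pE; rewrite gE pE /= mul1mx.
Qed.

(** Both [B * A] and 1 represent the identity [h \o g], so they agree by uniqueness of the
    representing element. *)
Lemma represents_inv i j A B (g : point_on (line_of M i) -> point_on (line_of M j))
    (h : point_on (line_of M j) -> point_on (line_of M i)) :
  represents A g -> represents B h -> cancel g h -> (A^-1)%g = B.
Proof.
move=> rA rB gK; apply/invg_inj; rewrite invgK; apply/esym/mulg1_eq.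
apply: (represents_inj (represents_mul rA rB)).
exact: represents_id gK.
Qed.

Lemma FijkV i j k : uniq [:: i; j; k] -> ((Fijk M i j k)^-1)%g = Fijk M j i k.
Proof.
rewrite -skew3_line_of => s; have s' := skew3_sym12 s.
by apply: represents_inv (Fijk_represents s) (Fijk_represents s') (fijkK s s').
Qed.

Lemma Gi_subgroup i : inLL i -> subgroup (Gi M LL i).
Proof.
move=> iLL; split=> [|x y [g ag rg] [h ah rh]].
  (* [arrow] has no identity constructor: 1 comes from f_{jik} f_{ijk}, which takes two further
     lines of [LL]. *)
  have [j jLL /andP[ji _]] := third_line i i.
  have [k kLL /andP[ki kj]] := third_line i j.
  have s : skew3 (line_of M i) (line_of M j) (line_of M k).
    by rewrite skew3_line_of /= !inE negb_or !(eq_sym i) ji ki eq_sym kj.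
  have s' := skew3_sym12 s.
  exists (fijk s' \o fijk s); first by apply: arrow_comp; apply: arrow_f.
  exact: represents_id (fijkK s s').
have [h' ah' hK] := arrow_inverse ah.
have [B rB] := arrow_represented LL_line ah'.
exists (g \o h'); first exact: arrow_comp.
by rewrite (represents_inv rh rB hK); apply: represents_mul.
Qed.

Lemma closed_compositions_Gi i A : closed_compositions M LL i A -> Gi M LL i A.
Proof.
case=> [[j [k [h []]]]|[j [k [a [b [c []]]]]]].
  case/and5P=> iL jL kL hL _; rewrite -!skew3_line_of => s1 s2 ->.
  exists (fijk s2 \o fijk s1); first by apply: arrow_comp; apply: arrow_f.
  by apply: represents_mul; apply: Fijk_represents.
case/and5P=> iL jL kL aL /and3P[bL cL _]; rewrite -!skew3_line_of => s1 s2 s3 ->.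
exists (fijk s3 \o (fijk s2 \o fijk s1)).
  by do 2?apply: arrow_comp; apply: arrow_f.
by rewrite -mulgA; do 2?apply: represents_mul; apply: Fijk_represents.
Qed.

(** * Loops along a spanning tree *)

Section SpanningTree.
Variables (i : index) (T : index -> PGL2 K).
Hypothesis iLL : inLL i.
Hypothesis T_i : T i = 1%g.
Hypothesis T_F : forall a, inLL a -> a != i ->
  exists k, [/\ inLL k, uniq [:: i; a; k] & T a = Fijk M i a k].

Lemma tree_loop a b c :
  inLL a -> inLL b -> inLL c -> uniq [:: a; b; c] ->
  generated (closed_compositions M LL i) ((T b)^-1 * Fijk M a b c * T a)%g.
Proof.
move=> aL bL cL abc.
have [ai|ai] := eqVneq a i.
  rewrite {}ai in aL abc *; rewrite T_i mulg1.
  have bi : b != i by move: abc; rewrite /= !inE negb_or eq_sym; case: eqVneq.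
  have [k [kL ibk ->]] := T_F bL bi.
  (* The loop is F_{bik} F_{ibc}. *)
  move=> H sH XH; apply: XH; left; exists b, c, k; rewrite FijkV //.
  split=> //; first by rewrite /= aL bL cL kL.
  by move: ibk; rewrite /= !inE !negb_or (eq_sym b i) => /and3P[/andP[-> ->] -> _].
have [k [kL iak ->]] := T_F aL ai.
have [bi|bi] := eqVneq b i.
  rewrite {}bi in bL abc *; rewrite T_i invg1 mul1g.
  move=> H sH XH; apply: XH; left; exists a, k, c.
  by split=> //=; rewrite aL bL cL kL.
have [l [lL ibl ->]] := T_F bL bi.
(* Neither end is [i]: the loop is F_{bil} F_{abc} F_{iak}. *)
move=> H sH XH; apply: XH; right; exists a, b, k, c, l; rewrite FijkV //.
split=> //; first by rewrite /= iLL aL bL cL kL lL.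
by move: ibl; rewrite /= !inE !negb_or (eq_sym b i) => /and3P[/andP[-> ->] -> _].
Qed.

(* [represents A g] is spelled out, since the type of [g] mentions [L] and [L']
   and not [line_of M a] and [line_of M b]. *)
Lemma arrow_tree_loop L L' (g : point_on L -> point_on L') : arrow LL g ->
  forall a b, L = line_of M a -> L' = line_of M b ->
  exists2 A : PGL2 K,
    forall p v, val p = <[param M a v]>%VS ->
      val (g p) = <[param M b (val (repr A) *m v)]>%VS &
    generated (closed_compositions M LL i) ((T b)^-1 * A * T a)%g.
Proof.
elim=> {L L' g} [La Lb Lc s aL bL cL|L L1 L' g h ag IHg ah IHh] a b aE bE.
  have [c cE] := LL_line cL; subst La Lb Lc.
  exists (Fijk M a b c); first exact: (Fijk_represents s).
  by apply: tree_loop => //; rewrite -skew3_line_of.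
have [_ L1L] := arrow_mem ag; have [c cE] := LL_line L1L.
have [A rA gA] := IHg a c aE cE; have [B rB gB] := IHh c b cE bE.
subst L L1 L'; exists (B * A)%g; first exact: (represents_mul rA rB).
(* In (T_b^-1 B T_c)(T_c^-1 A T_a) the inner tree factors cancel. *)
have := subgroupM (@generated_subgroup _ _) gB gA.
by rewrite !mulgA mulgK.
Qed.

(** For a path from [i] to [i] both outer tree factors are 1. *)
Lemma Gi_generated A : Gi M LL i A -> generated (closed_compositions M LL i) A.
Proof.
case=> g ag rA; have [B rB] := arrow_tree_loop ag (erefl (line_of M i)) (erefl _).
by rewrite T_i invg1 mul1g mulg1 (represents_inj rA rB).
Qed.

End SpanningTree.

Lemma spanning_tree i : inLL i ->
  exists2 T : index -> PGL2 K, T i = 1%g &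
    forall a, inLL a -> a != i ->
      exists k, [/\ inLL k, uniq [:: i; a; k] & T a = Fijk M i a k].
Proof.
move=> iLL.
(* The default [i] is never reached, by [third_line]. *)
pose k a := odflt i [pick k | inLL k && (k != i) && (k != a)].
exists (fun a => if a == i then 1%g else Fijk M i a (k a)); first by rewrite eqxx.
move=> a aL ai; exists (k a); rewrite (negPf ai) /k.
case: pickP => [c /andP[/andP[cL ci] ca]|none] /=.
  by rewrite cL !inE negb_or !(eq_sym _ c) eq_sym ai ci ca.
by have [c cL /andP[ci ca]] := third_line i a; have := none c; rewrite cL ci ca.
Qed.

Lemma Gi_eq_generated i A : inLL i ->
  Gi M LL i A <-> generated (closed_compositions M LL i) A.
Proof.
move=> iLL; have [T T_i T_F] := spanning_tree iLL.
split; first exact: (Gi_generated iLL T_i T_F).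
by apply; [apply: Gi_subgroup | apply: closed_compositions_Gi].
Qed.

End Groupoid.

End GroupoidGenerators.

Theorem theorem2p6 (K : closedFieldType) (r : nat) (M : 'I_r.+1 -> 'M[K]_2)
    (M_0 : forall a : 'I_r.+1, a = 0%N :> nat -> M a = 0)
    (M_1 : forall a : 'I_r.+1, a = 1%N :> nat -> M a = 1%:M)
    (M_unit : forall a : 'I_r.+1, (2 <= a)%N -> M a \in unitmx)
    (skewL : forall i j : option 'I_r.+1, i != j -> skew_lines (line_of M i) (line_of M j))
    (LL : {fset line K})
    (LL_sub : (LL `<=` [fset line_of M i | i : option 'I_r.+1])%fset)
    (LL_card : (3 <= #|` LL|)%N)
    (i : option 'I_r.+1) (iLL : line_of M i \in LL) (A : PGL2 K) :
  Gi M LL i A <-> generated (closed_compositions M LL i) A.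
Proof.
apply: Gi_eq_generated => // L /(fsubsetP LL_sub) /imfsetP[j _ ->].
by exists j.
Qed.
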